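(* Let $p$ be a prime with $p\equiv 5$ or $7 \pmod 8$. Then for all integers $n,k\ge 0$ with $p\nmid n$, $$s_1\left(p^{2k+1}n+\frac{p^{2k+2}-1}{8}\right)\equiv 0 \pmod 8.$$
   Context: Let $q$ be a complex number with $|q|<1$ (or a formal variable). Write $(a;q)_\infty=\prod_{k=0}^\infty(1-aq^k)$. The integers $s_1(n)$, $n\ge 0$, are defined as the coefficients of the power series $$\sum_{n=0}^\infty s_1(n)q^n = S_1(q)=\sum_{n=0}^\infty (-q^{n+1};q)_\infty^2\, q^n .$$ *)

(* Defs.v *)
From mathcomp Require Import all_boot all_order all_algebra.
From mathcomp Require Import boolp classical_sets filter.

Set Implicit Arguments.
Unset Strict Implicit.
Unset Printing Implicit Defensive.

Import GRing.Theory.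
Local Open Scope ring_scope.

(* An element of Z[[q]], given by its sequence of coefficients; the            *)
(* indeterminate q is the variable 'X of {poly int}.                          *)
Definition fps := nat -> int.

Definition fps_of_poly (f : {poly int}) : fps := fun m => f`_m.

Definition fps_mul (f g : fps) : fps :=
  fun m => \sum_(i < m.+1) f i * g (m - i)%N.

(* q-adic limit: the coefficient of q^m in the limit is the eventual value of  *)
(* the coefficient of q^m in u N. It is 0 by convention where there is no      *)
(* eventual value, but see qpoch_inf_cvg and S1_cvg.                          *)
Definition fps_lim (u : nat -> fps) : fps :=
  fun m => xget 0 [set c | \forall N \near \oo, u N m = c]%classic.

(* (a;q)_oo; a need not have zero constant term, since a q^k tends to 0.       *)
Definition qpoch_inf (a : {poly int}) : fps :=
  fps_lim (fun N => fps_of_poly (\prod_(k < N) (1 - a * 'X^k))).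

Definition S1_term (n : nat) : fps :=
  fps_mul (fps_mul (qpoch_inf (- 'X^(n.+1))) (qpoch_inf (- 'X^(n.+1))))
          (fps_of_poly 'X^n).

Definition S1 : fps := fps_lim (fun N m => \sum_(n < N) S1_term n m).

Definition s1 (n : nat) : int := S1 n.

Lemma fps_lim_eventually (u : nat -> fps) (m M : nat) (c : int) :
  (forall N, (M <= N)%N -> u N m = c) -> fps_lim u m = c.
Proof.
move=> uc; have cP : (\forall N \near \oo, u N m = c)%classic by exists M.
rewrite /fps_lim; case: xgetP => [d _ [K _ dP]|/(_ c)/(_ cP)] //.
by rewrite -(dP (maxn K M)) ?uc //= ?leq_maxl ?leq_maxr.
Qed.

Lemma qpoch_inf_cvg (a : {poly int}) (m N : nat) :
  (m < N)%N -> (\prod_(k < N) (1 - a * 'X^k))`_m = qpoch_inf a m.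
Proof.
have st K : (m < K)%N ->
    (\prod_(k < K) (1 - a * 'X^k))`_m = (\prod_(k < m.+1) (1 - a * 'X^k))`_m.
  elim: K => // K IH; rewrite ltnS leq_eqVlt => /predU1P[->//|mK].
  rewrite big_ord_recr /= mulrBr mulr1 coefB IH // mulrA coefMXn mK.
  by rewrite subr0.
by move=> /st->; apply/esym/(@fps_lim_eventually _ _ m.+1) => K /st.
Qed.

Lemma S1_cvg (m N : nat) : (m < N)%N -> \sum_(n < N) S1_term n m = S1 m.
Proof.
have z n : (m < n)%N -> S1_term n m = 0.
  move=> mn; rewrite /S1_term {1}/fps_mul big1 // => i _.
  by rewrite /fps_of_poly coefXn ltn_eqF ?mulr0 // (leq_ltn_trans _ mn) ?leq_subr.
have st K : (m < K)%N ->
    \sum_(n < K) S1_term n m = \sum_(n < m.+1) S1_term n m.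
  elim: K => // K IH; rewrite ltnS leq_eqVlt => /predU1P[->//|mK].
  by rewrite big_ord_recr /= IH // z // addr0.
by move=> /st->; apply/esym/(@fps_lim_eventually _ _ m.+1) => K /st.
Qed.

(* Main.v *)
Require Import Defs.
From mathcomp Require Import all_boot all_order all_algebra.
From mathcomp Require Import zify ring.

(** Write (a)_oo = (a;q)_oo and set
        S(z) = sum_{n >= 0} q^n (-z q^(n+1))_oo (-q^(n+1)/z)_oo,
    so that the series S_1 is S(1).  A telescoping sum in n gives the
    q-difference equation
        S(z) = (1 - z^2 q) ((1 + z) (-zq)_oo (-q/z)_oo - z) + z^4 q^2 S(zq),
    and iterating it from z = 1 along z = q^m produces Ramanujan's identity
        S_1 = 2 (-q)_oo^2 F - H,
    where F = sum_{m >= 0} q^(m(3m+1)/2) (1 - q^(2m+1)) is a false theta series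
    and H = sum_{n >= 0} (-1)^n q^(n(n+1)/2).

    Changing the sign of the terms of odd index turns F into Euler's pentagonal
    series, so F = (q)_oo + 2 G with G supported on pentagonal exponents.
    Gauss's identity (-q)_oo^2 (q)_oo = sum_{n >= 0} q^(n(n+1)/2) =: psi, and the
    factorwise congruence (-q)_oo^2 = (q^2;q^2)_oo + 2 Y, then give
        S_1 = 2 psi - H + 4 G (q^2;q^2)_oo + 8 Y G.
    Completing squares in the exponents, by the pentagonal number theorem for
    q^2, every exponent e of psi, H and G (q^2;q^2)_oo is such that 24 e + 3 has
    the form x^2 + 2 y^2.  Hence 8 divides s_1(e) as soon as 24 e + 3 does not
    have this form (lemma [dvd8_s1]).

    For e = p^(2k+1) n + (p^(2k+2) - 1)/8 we have
    24 e + 3 = 3 p^(2k+1) (8n + p), whose p-adic valuation is odd.  As -2 is not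
    a square modulo a prime p = 5, 7 mod 8, a number x^2 + 2 y^2 is divisible by
    p to an even power only, and the theorem follows.

    The q-series are handled in an arbitrary commutative ring in which
    q^N = 0: infinite products and sums become finite there, every identity
    is an honest equality, and the ring Z[X]/(X^N) recovers the coefficients of
    index below N. *)

Set Implicit Arguments.
Unset Strict Implicit.
Unset Printing Implicit Defensive.

Import GRing.Theory.
Local Open Scope ring_scope.

(** * Triangular and pentagonal exponents *)

(** The generalized pentagonal number m(3m+1)/2, written without division; the
    one of index -m-1 is [pent m + (2 * m + 1)]. *)
Definition pent (m : nat) : nat := (3 * 'C(m, 2) + 2 * m)%N.

Lemma bin2S (m : nat) : 'C(m.+1, 2) = ('C(m, 2) + m)%N.
Proof. by rewrite binS bin1. Qed.

Lemma pentS (m : nat) : pent m.+1 = (pent m + (3 * m + 2))%N.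
Proof. rewrite /pent bin2S; lia. Qed.

Lemma sqr_bin2 (m : nat) : (8 * 'C(m.+1, 2) + 1 = (2 * m + 1) ^ 2)%N.
Proof. by elim: m => // m IH; rewrite bin2S; nia. Qed.

Lemma sqr_pent (m : nat) : (24 * pent m + 1 = (6 * m + 1) ^ 2)%N.
Proof. by elim: m => // m IH; rewrite pentS; nia. Qed.

Lemma sqr_pent_neg (m : nat) :
  (24 * (pent m + (2 * m + 1)) + 1 = (6 * m + 5) ^ 2)%N.
Proof. by have := sqr_pent m; nia. Qed.

Lemma pent_add_bin2 (m : nat) : (pent m + 'C(m.+1, 2) = 'C((2 * m).+1, 2))%N.
Proof. by have := (sqr_pent m, sqr_bin2 m, sqr_bin2 (2 * m)) => -[[]]; nia. Qed.

(** * Prime divisors of x^2 + 2 y^2 *)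

Section Arithmetic.
Local Open Scope nat_scope.

(** Descent on d, prime or not: a divisor d = 5, 7 mod 8 of x^2 + 2 may be
    assumed to divide y^2 + 2 with y odd and y < d.  The cofactor m of d in
    y^2 + 2 is then less than d, and m d = 3 mod 8 forces m = 7, 5 mod 8, so that
    m is a smaller divisor of the same kind. *)
Lemma odd_form_ndvd (d x : nat) :
  d = 5 %[mod 8] \/ d = 7 %[mod 8] -> ~~ (d %| x ^ 2 + 2).
Proof.
elim/ltn_ind: d x => d IH x d57; apply/negP => dx.
have [y [y_odd y_lt dy]] : exists y, [/\ odd y, y < d & d %| y ^ 2 + 2].
  have d_gt0 : 0 < d by case: d d57 {IH dx} => // [[]].
  have dr : d %| (x %% d) ^ 2 + 2.
    by move: dx; rewrite /dvdn -modnDml -modnXm modnDml.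
  have r_lt := ltn_pmod x d_gt0; move: (x %% d) r_lt dr => r r_lt dr.
  have [r_odd|r_even] := boolP (odd r); first by exists r.
  have r_gt0 : 0 < r.
    by rewrite lt0n; apply: contraL dr => /eqP ->; apply/negP => /dvdn_leq; lia.
  (* d is odd, so d - r has the other parity and the same square mod d. *)
  exists (d - r); split; [lia|lia|].
  rewrite -(dvdn_addl _ (dvdn_mull r.*2 (dvdnn d))).
  have -> : (d - r) ^ 2 + 2 + r.*2 * d = d * d + (r ^ 2 + 2).
    by rewrite -(subnKC (ltnW r_lt)) addKn -mul2n; ring.
  by rewrite dvdn_addr ?dvdn_mull.
have /dvdnP [m e] := dy.
(* An odd square is 1 mod 8, being 8 times a triangular number plus 1. *)
have ysq : (y ^ 2 + 2) %% 8 = 3.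
  rewrite -[y](odd_double_half y) y_odd -muln2.
  have -> : (true + y./2 * 2) ^ 2 + 2 = (y./2 * y./2.+1)./2 * 8 + 3.
    have := odd_double_half (y./2 * y./2.+1).
    rewrite oddM /= andbN -muln2 => E; nia.
  by rewrite modnMDl.
have md : m < d.
  rewrite -(@ltn_pmul2r d) ?(leq_ltn_trans _ y_lt) // -e.
  apply: leq_trans (leq_mul y_lt y_lt).
  by case: y y_odd {y_lt dy e ysq} => // y _; rewrite -mulnn !mulSn !mulnS; lia.
suff m57 : m = 5 %[mod 8] \/ m = 7 %[mod 8].
  by have /negP[] := IH m md y m57; rewrite e dvdn_mulr.
move: ysq; rewrite e -modnMm.
have := ltn_pmod m (isT : 0 < 8).
case: d57 => ->; move: (m %% 8); do 8?[case=> //] => //; by [left | right].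
Qed.

(** If p did not divide y, then y would have an inverse u mod p, and p would
    divide (x u)^2 + 2. *)
Lemma prime_dvd_form (p x y : nat) : prime p ->
  p = 5 %[mod 8] \/ p = 7 %[mod 8] ->
  p %| x ^ 2 + 2 * y ^ 2 -> (p %| x) && (p %| y).
Proof.
move=> p_pr p57 pxy.
have py : p %| y.
  apply/negPn/negP => pNy.
  have p_gt0 := prime_gt0 p_pr.
  have y_gt0 : 0 < y by case: y pNy {pxy}; rewrite ?dvdn0.
  have [u v uv _] := egcdnP p y_gt0.
  have cop : gcdn y p = 1 by apply/eqP; rewrite gcdnC -/(coprime p y) prime_coprime.
  have /negP[] := odd_form_ndvd (x * u) p57.
  have : p %| u ^ 2 * (x ^ 2 + 2 * y ^ 2) by rewrite dvdn_mull.
  have -> : u ^ 2 * (x ^ 2 + 2 * y ^ 2) = (x * u) ^ 2 + 2 * (u * y) ^ 2 by ring.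
  rewrite uv cop.
  have -> : (x * u) ^ 2 + 2 * (v * p + 1) ^ 2
    = ((x * u) ^ 2 + 2) + 2 * (v * p * v + 2 * v) * p by ring.
  by rewrite dvdn_addl // dvdn_mull.
rewrite py andbT; move: pxy; rewrite dvdn_addl ?Euclid_dvdX //.
  by case/andP.
by rewrite dvdn_mull // Euclid_dvdX // py.
Qed.

(** Infinite descent: if p divides x^2 + 2 y^2, both x and y can be divided by
    p, which lowers the exponent of p by exactly two. *)
Lemma odd_pow_ne_form (p c k x y : nat) : prime p ->
  p = 5 %[mod 8] \/ p = 7 %[mod 8] -> ~~ (p %| c) ->
  p ^ (2 * k + 1) * c <> x ^ 2 + 2 * y ^ 2.
Proof.
move=> p_pr p57 pNc; have p_gt0 := prime_gt0 p_pr.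
elim: k x y => [|k IH] x y e.
all: have : p %| x ^ 2 + 2 * y ^ 2 by rewrite -e dvdn_mulr // addn1 expnS dvdn_mulr.
all: move/(prime_dvd_form p_pr p57)/andP => [/dvdnP[x' ex] /dvdnP[y' ey]]; subst.
  case/negP: pNc; rewrite -(dvdn_pmul2l p_gt0); apply/dvdnP.
  by exists (x' ^ 2 + 2 * y' ^ 2); move: e; rewrite muln0 add0n expn1 => ->; ring.
apply: (IH x' y'); apply/eqP; rewrite -(eqn_pmul2l (_ : 0 < p ^ 2)) ?expn_gt0 ?p_gt0 //.
apply/eqP; rewrite mulnA -expnD; move: e.
have -> : 2 * k.+1 + 1 = 2 + (2 * k + 1) by lia.
by move=> ->; ring.
Qed.
End Arithmetic.

(** * Finite forms of the theta identities of Euler and Gauss *)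

Section FiniteIdentities.
Variables (R : comNzRingType) (q : R).

(** The pentagonal series with the terms of index m and -m-1 grouped. *)
Definition euler_sum (n : nat) : R :=
  \sum_(m < n) (-1) ^+ m * q ^+ pent m * (1 - q ^+ (2 * m + 1)).

(** Shanks's finite form of the pentagonal number theorem: modulo q^n only the
    term s = 0, which is (q)_n, remains on the left.  By induction on n; the
    increment of the left-hand side telescopes in s. *)
Lemma pentagonal_finite (n : nat) :
  \sum_(0 <= s < n) (-1) ^+ s * (\prod_(s <= k < n) (1 - q ^+ k.+1)) *
     q ^+ (s * n + 'C(s.+1, 2)) = euler_sum n.
Proof.
rewrite /euler_sum; elim: n => [|n IH]; first by rewrite big_nil big_ord0.
rewrite big_ord_recr /= -IH => {IH}.
rewrite big_nat_recr //= big_nat1.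
pose D s := \prod_(s <= k < n) (1 - q ^+ k.+1).
(* The factor 1 - q^s makes [v 0] vanish. *)
pose v s := (-1) ^+ s * (1 - q ^+ s) * D s * q ^+ (s * n + 'C(s.+1, 2)).
have step : \sum_(0 <= s < n) ((-1) ^+ s * (\prod_(s <= k < n.+1) (1 - q ^+ k.+1)) *
     q ^+ (s * n.+1 + 'C(s.+1, 2)) - (-1) ^+ s * D s * q ^+ (s * n + 'C(s.+1, 2)))
   = v n - v 0%N.
  apply: telescope_sumr_eq => // s /andP[_ sn].
  rewrite big_nat_recr 1?ltnW //= -/(D s) /v /D big_ltn // -/(D s.+1).
  rewrite (bin2S s.+1) mulSn mulnS !exprD !exprS; ring.
move: step; rewrite sumrB => /eqP; rewrite subr_eq => /eqP ->.
rewrite /v /D big_geq // expr0.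
rewrite [in 'C(1, 2)]bin_small // !mul0n.
have -> : pent n = (n * n + 'C(n.+1, 2))%N.
  by rewrite /pent; elim: n {D v} => // n IH; rewrite !bin2S in IH *; nia.
have -> : (n * n.+1 = n * n + n)%N by lia.
have -> : (2 * n + 1 = n + n + 1)%N by lia.
rewrite !exprD !exprS; ring.
Qed.

Definition odd_prod (n : nat) : R := \prod_(k < n) (1 - q ^+ (2 * k + 1)).

(** Shanks's finite form of Gauss's identity
    (q^2;q^2)_oo = (q;q^2)_oo * sum_k q^(k(k+1)/2); again all the terms s > 0 on
    the left are small, and the proof is the same telescoping. *)
Lemma gauss_finite (n : nat) :
  \sum_(0 <= s < n) q ^+ (s * (2 * n + 1)) *
     (\prod_(s <= k < n) (1 - q ^+ (2 * k.+1))) * odd_prod s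
  = odd_prod n * \sum_(k < n) (q ^+ 'C((2 * k).+1, 2) + q ^+ 'C((2 * k).+2, 2)).
Proof.
elim: n => [|n IH]; first by rewrite big_nil big_ord0 mulr0.
have OS s : odd_prod s.+1 = odd_prod s * (1 - q ^+ (2 * s + 1)).
  by rewrite /odd_prod big_ord_recr.
rewrite big_ord_recr /= mulrDr {1}OS (mulrAC (odd_prod n)) -IH => {IH}.
rewrite big_nat_recr //= big_nat1.
pose D s := \prod_(s <= k < n) (1 - q ^+ (2 * k.+1)).
(* The factor 1 - q^(2s) makes [v 0] vanish. *)
pose v s := (1 - q ^+ (2 * s)) * q ^+ (s * (2 * n + 1)) * D s * odd_prod s.
have step : \sum_(0 <= s < n) (q ^+ (s * (2 * n.+1 + 1)) *
     (\prod_(s <= k < n.+1) (1 - q ^+ (2 * k.+1))) * odd_prod s -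
     q ^+ (s * (2 * n + 1)) * D s * odd_prod s * (1 - q ^+ (2 * n + 1)))
   = v n - v 0%N.
  apply: telescope_sumr_eq => // s /andP[_ sn].
  rewrite big_nat_recr 1?ltnW //= -/(D s) /v /D big_ltn // -/(D s.+1) OS.
  have -> : (s * (2 * n.+1 + 1) = s * (2 * n + 1) + 2 * s)%N by lia.
  have -> : (2 * n.+1 = (2 * n + 1) + 1)%N by lia.
  have -> : (s.+1 * (2 * n + 1) = s * (2 * n + 1) + (2 * n + 1))%N by lia.
  have -> : (2 * s.+1 = 2 * s + 2)%N by lia.
  rewrite !(exprD q (s * _)) !(exprD q (2 * s)) !(exprD q (2 * n + 1)).
  ring.
move: step; rewrite sumrB -mulr_suml => /eqP; rewrite subr_eq => /eqP ->.
rewrite /v /D big_geq // OS.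
have -> : (n * (2 * n.+1 + 1) = n * (2 * n + 1) + 2 * n)%N by lia.
have e : 'C((2 * n).+1, 2) = (n * (2 * n + 1))%N.
  elim: n {D v} => // n IH.
  have -> : (2 * n.+1 = (2 * n).+2)%N by lia.
  by rewrite 2!bin2S IH; ring.
rewrite (bin2S (2 * n).+1) e -(addn1 (2 * n)) mul0n muln0 expr0.
have -> : (2 * n.+1 = 2 * n + 2)%N by lia.
rewrite !(exprD q (n * _)) !(exprD q (2 * n)); ring.
Qed.

(** Finite form of Euler's identity (-q)_oo (q;q^2)_oo = 1.  Passing from n to
    n + 1 trades the factor 1 - q^(n+1) for 1 - q^(2n+2), whose quotient is
    the new factor 1 + q^(n+1). *)
Lemma euler_odd_finite (n : nat) :
  (\prod_(k < n) (1 + q ^+ k.+1)) * odd_prod n =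
  \prod_(n <= k < 2 * n) (1 - q ^+ k.+1).
Proof.
elim: n => [|n IH]; first by rewrite /odd_prod !big_ord0 big_geq // mulr1.
rewrite /odd_prod !big_ord_recr /= mulrACA -/(odd_prod n) IH.
case: n {IH} => [|n].
  by rewrite big_geq // big_nat1 muln0 add0n !expr1; ring.
rewrite [LHS]mulrC big_ltn; last by lia.
have -> : (2 * n.+2 = (2 * n.+1).+2)%N by lia.
rewrite (big_nat_recr (2 * n.+1).+1) /=; last by lia.
rewrite (big_nat_recr (2 * n.+1)) /=; last by lia.
have -> : ((2 * n.+1).+2 = n.+2 + n.+2)%N by lia.
rewrite addn1 !exprD; ring.
Qed.
End FiniteIdentities.

(** * Ramanujan's identity for S_1, modulo q^N *)

Section Nilpotent.
Variables (R : comNzRingType) (q : R) (N : nat).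
Hypothesis qN0 : q ^+ N = 0.

Lemma expr_ge (a : nat) : (N <= a)%N -> q ^+ a = 0.
Proof. by move=> /subnKC <-; rewrite exprD qN0 mul0r. Qed.

Lemma nilp_exp_gt0 : (0 < N)%N.
Proof. by case: N qN0 => // /eqP; rewrite expr0 oner_eq0. Qed.

(** This is (-q^a;q)_oo, since the factors beyond the N-th one equal 1. *)
Definition negpoch (a : nat) : R := \prod_(k < N) (1 + q ^+ (a + k)).

Lemma negpoch_ge (a : nat) : (N <= a)%N -> negpoch a = 1.
Proof.
by move=> Na; apply: big1 => k _; rewrite expr_ge ?addr0 // (leq_trans Na) ?leq_addr.
Qed.

Lemma negpochS (a : nat) : negpoch a = (1 + q ^+ a) * negpoch a.+1.
Proof.
have E : \prod_(k < N.+1) (1 + q ^+ (a + k)) = negpoch a.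
  by rewrite big_ord_recr /= (@expr_ge (a + N)) ?leq_addl // addr0 mulr1.
rewrite -E big_ord_recl addn0; congr (_ * _).
by apply: eq_bigr => k _; rewrite /= /bump leq0n addnS.
Qed.

(** This is q^(m(m-1)/2) S(q^m).  The power of q clears the denominators: the
    factors of (-q^(n+1-m))_oo preceding (-q^(n+1))_oo are the 1 + q^(n-i) with
    i < m, and q^i (1 + q^(n-i)) = q^i + q^n. *)
Definition shifted_sum (m : nat) : R :=
  \sum_(0 <= n < N) q ^+ n * negpoch (n + m).+1 * negpoch n.+1 *
     \prod_(i < m) (q ^+ i + q ^+ n).

(** The q-difference equation of S at z = q^m.  The difference
    S(z) - z^4 q^2 S(zq) telescopes termwise in n through
    z (1 - z^2 q) (-z q^(n+1))_oo (-q^n/z)_oo, which is [t n] up to the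
    normalizing power of q. *)
Lemma shifted_sumS (m : nat) :
  shifted_sum m = (1 - q ^+ (2 * m + 1)) * (2 * negpoch 1 ^+ 2 - q ^+ 'C(m.+1, 2))
                  + q ^+ (3 * m + 2) * shifted_sum m.+1.
Proof.
pose t n := (1 - q ^+ (2 * m + 1)) * negpoch (n + m).+1 * negpoch n.+1 *
  \prod_(i < m.+1) (q ^+ i + q ^+ n).
have step : \sum_(0 <= n < N) (q ^+ n * negpoch (n + m).+1 * negpoch n.+1 *
     (\prod_(i < m) (q ^+ i + q ^+ n)) - q ^+ (3 * m + 2) *
     (q ^+ n * negpoch (n + m.+1).+1 * negpoch n.+1 *
     \prod_(i < m.+1) (q ^+ i + q ^+ n))) = - t N - - t 0%N.
  apply: (@telescope_sumr_eq _ _ _ (fun n => - t n)) => // n _.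
  have -> : (3 * m + 2 = m + m + m + 2)%N by lia.
  rewrite /t addSn (addnS n m) (negpochS (n + m).+1).
  have -> : \prod_(i < m.+1) (q ^+ i + q ^+ n.+1) =
     (1 + q ^+ n.+1) * (q ^+ m * \prod_(i < m) (q ^+ i + q ^+ n)).
    rewrite big_ord_recl expr0; congr (_ * _).
    under eq_bigr => i _ do rewrite /= /bump leq0n add1n !exprS -mulrDr.
    by rewrite big_split prodr_const card_ord.
  rewrite big_ord_recr /= (negpochS n.+1).
  have -> : (2 * m + 1 = m + m + 1)%N by lia.
  rewrite !(exprS, exprD); ring.
have t0 : t 0%N = (1 - q ^+ (2 * m + 1)) * (2 * negpoch 1 ^+ 2).
  rewrite /t add0n big_ord_recl /= !expr0.
  have -> : negpoch 1 = \prod_(i < m) (1 + q ^+ i.+1) * negpoch m.+1.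
    elim: {t step} m => [|m IH]; first by rewrite big_ord0 mul1r.
    by rewrite IH big_ord_recr /= (negpochS m.+1) mulrA.
  under [\prod_(i < m) (q ^+ bump 0 i + 1)]eq_bigr => i _ do
    rewrite /bump leq0n add1n addrC.
  ring.
have tN : t N = (1 - q ^+ (2 * m + 1)) * q ^+ 'C(m.+1, 2).
  rewrite /t !negpoch_ge ?mulr1 //; try lia; congr (_ * _).
  under eq_bigr => i _ do rewrite qN0 addr0.
  rewrite prodrXr; congr (_ ^+ _).
  by rewrite -(big_mkord xpredT id) bin2_sum.
move: step; rewrite sumrB -mulr_sumr => /eqP; rewrite subr_eq => /eqP.
rewrite /shifted_sum => ->; rewrite t0 tN; ring.
Qed.

(** Partial sums of F: it is the pentagonal series without its signs. *)
Definition false_theta (n : nat) : R :=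
  \sum_(m < n) q ^+ pent m * (1 - q ^+ (2 * m + 1)).

(** Partial sums of H: the m-th term groups the triangular exponents of index 2m
    and 2m+1, see [pent_add_bin2]. *)
Definition alt_theta (n : nat) : R :=
  \sum_(m < n) q ^+ (pent m + 'C(m.+1, 2)) * (1 - q ^+ (2 * m + 1)).

(** Iterate the q-difference equation; the remainder after N steps carries the
    factor q^(pent N) = 0. *)
Lemma shifted_sum0 :
  shifted_sum 0 = 2 * negpoch 1 ^+ 2 * false_theta N - alt_theta N.
Proof.
suff E n : shifted_sum 0 = 2 * negpoch 1 ^+ 2 * false_theta n - alt_theta n +
    q ^+ pent n * shifted_sum n.
  have le_pent : (N <= pent N)%N by rewrite /pent; lia.
  by rewrite (E N) (expr_ge le_pent) mul0r addr0.
elim: n => [|n IH].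
  by rewrite /false_theta /alt_theta !big_ord0 expr0; ring.
rewrite IH shifted_sumS /false_theta /alt_theta !big_ord_recr /= pentS !exprD.
ring.
Qed.

Lemma pentagonal : \prod_(k < N) (1 - q ^+ k.+1) = euler_sum q N.
Proof.
rewrite -pentagonal_finite.
rewrite big_ltn ?nilp_exp_gt0 // [X in _ + X]big_nat_cond [X in _ + X]big1 ?addr0.
  by rewrite mul0n expr0 mulr1 mul1r big_mkord.
move=> s /andP[/andP[s0 _] _]; rewrite expr_ge ?mulr0 //; nia.
Qed.

(** Gauss's product (q^2;q^2)_oo / (q;q^2)_oo takes this form because
    (-q)_oo is the inverse of (q;q^2)_oo. *)
Lemma gauss :
  negpoch 1 ^+ 2 * \prod_(k < N) (1 - q ^+ k.+1) =
  \sum_(k < N) (q ^+ 'C((2 * k).+1, 2) + q ^+ 'C((2 * k).+2, 2)).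
Proof.
have r1 : \prod_(k < N) (1 + q ^+ k.+1) = negpoch 1 by [].
have eO : negpoch 1 * odd_prod q N = 1.
  rewrite -r1 euler_odd_finite big_nat_cond big1 // => k /andP[/andP[Nk _] _].
  by rewrite expr_ge ?subr0 // ltnW.
rewrite -[RHS]mul1r -[X in _ = X * _]eO -[RHS]mulrA -gauss_finite expr2 -mulrA.
congr (_ * _).
rewrite big_ltn ?nilp_exp_gt0 // [X in _ + X]big_nat_cond [X in _ + X]big1 ?addr0.
  rewrite mul0n expr0 /odd_prod big_ord0 mulr1 mul1r big_mkord -r1 -big_split /=.
  by apply: eq_bigr => k _; rewrite mul2n -addnn exprD; ring.
move=> s /andP[/andP[s0 _] _]; rewrite expr_ge ?mul0r //; nia.
Qed.

(** * The coefficients of S_1 modulo 8 *)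

(** Partial sums of G, half the difference between F and the pentagonal
    series. *)
Definition odd_theta (n : nat) : R :=
  \sum_(m < n | odd m) q ^+ pent m * (1 - q ^+ (2 * m + 1)).

Lemma false_theta_euler (n : nat) :
  false_theta n = euler_sum q n + 2 * odd_theta n.
Proof.
rewrite /odd_theta big_mkcond mulr_sumr -big_split /=; apply: eq_bigr => m _.
by rewrite -signr_odd; case: (odd m); rewrite ?expr1 ?expr0; ring.
Qed.

(** Factorwise, (1 + x)^2 = (1 - x^2) + 2 (x + x^2). *)
Lemma negpoch_sqr_mod2 :
  exists Y, negpoch 1 ^+ 2 = \prod_(k < N) (1 - (q ^+ 2) ^+ k.+1) + 2 * Y.
Proof.
rewrite /negpoch -prodrXl; apply: (big_ind2 (fun x y => exists Y, x = y + 2 * Y)).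
- by exists 0; rewrite mulr0 addr0.
- move=> x1 x2 y1 y2 [Y ->] [Z ->]; exists (Y * y2 + x2 * Z + 2 * Y * Z); ring.
- move=> k _; exists (q ^+ k.+1 + q ^+ k.+1 ^+ 2).
  by rewrite add1n -exprM mulnC exprM; ring.
Qed.

End Nilpotent.

(** The two halves of F are treated differently: the pentagonal series turns
    (-q)_oo^2 into psi exactly, while the other half already carries a factor
    4, so that (-q)_oo^2 matters there only modulo 2. *)
Lemma shifted_sum0_mod8 (R : comNzRingType) (q : R) (N : nat) :
  q ^+ N = 0 -> exists Y, shifted_sum q N 0 =
  2 * (\sum_(k < N) (q ^+ 'C((2 * k).+1, 2) + q ^+ 'C((2 * k).+2, 2)))
  - alt_theta q N + 4 * (odd_theta q N * euler_sum (q ^+ 2) N) + 8 * Y.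
Proof.
move=> qN0.
have q2N0 : (q ^+ 2) ^+ N = 0 by rewrite -exprM mulnC exprM qN0 expr0n.
have [Y eY] := negpoch_sqr_mod2 q N; exists (Y * odd_theta q N).
rewrite -(pentagonal q2N0) -(gauss qN0) (pentagonal qN0) (shifted_sum0 qN0).
by rewrite false_theta_euler mulrDr eY; ring.
Qed.

(** Up to sign and modulo 8, the sum is made of powers q^e such that 24 e + 3 is
    a value of x^2 + 2 y^2: for e triangular, 24 e + 3 = 3 (2m+1)^2 is the value
    at x = y = 2m+1, and for e = a + 2 b with a, b pentagonal it is
    (24 a + 1) + 2 (24 b + 1), a square plus twice a square. The additive map c
    stands for the extraction of a coefficient. *)
Lemma dvd8_coef_shifted_sum (R : comNzRingType) (q : R) (N : nat)
    (c : {additive R -> int}) : q ^+ N = 0 ->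
  (forall e x y, (24 * e + 3 = x ^ 2 + 2 * y ^ 2)%N -> c (q ^+ e) = 0) ->
  (8 %| c (shifted_sum q N 0))%Z.
Proof.
move=> qN0 c0.
have c_bin m : c (q ^+ 'C(m.+1, 2)) = 0.
  by apply: (c0 _ (2 * m + 1)%N (2 * m + 1)%N); have := sqr_bin2 m; lia.
have psi0 : c (\sum_(k < N)
    (q ^+ 'C((2 * k).+1, 2) + q ^+ 'C((2 * k).+2, 2))) = 0.
  by rewrite raddf_sum big1 // => k _; rewrite raddfD /= !c_bin addr0.
have alt0 : c (alt_theta q N) = 0.
  rewrite /alt_theta raddf_sum big1 // => k _.
  rewrite pent_add_bin2 mulrBr mulr1 -exprD raddfB /= addn1 -bin2S !c_bin.
  by rewrite subr0.
have mix0 : c (odd_theta q N * euler_sum (q ^+ 2) N) = 0.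
  rewrite /odd_theta mulr_suml raddf_sum big1 // => m _.
  rewrite /euler_sum mulr_sumr raddf_sum big1 //= => j _.
  set u := _ * (1 - q ^+ (2 * m + 1)); set v := _ ^+ pent j; set w := 1 - _.
  have -> : u * ((-1) ^+ j * v * w) = (-1) ^+ j * (u * (v * w)) by ring.
  suff z : c (u * (v * w)) = 0.
    by rewrite -signr_odd mulr_sign; case: (odd j); rewrite ?raddfN /= z ?oppr0.
  have -> : u * (v * w) = q ^+ (pent m + 2 * pent j)
     - q ^+ (pent m + 2 * (pent j + (2 * j + 1)))
     - q ^+ (pent m + (2 * m + 1) + 2 * pent j)
     + q ^+ (pent m + (2 * m + 1) + 2 * (pent j + (2 * j + 1))).
    by rewrite /u /v /w -!exprM !mulnDr !exprD; ring.
  rewrite raddfD !raddfB /=.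
  have c_form a b x y : (24 * a + 1 = x ^ 2)%N -> (24 * b + 1 = y ^ 2)%N ->
      c (q ^+ (a + 2 * b)) = 0.
    by move=> ax yb; apply: (c0 _ x y); rewrite -ax -yb; lia.
  rewrite !(c_form _ _ _ _ (sqr_pent _) (sqr_pent _)).
  rewrite !(c_form _ _ _ _ (sqr_pent _) (sqr_pent_neg _)).
  rewrite !(c_form _ _ _ _ (sqr_pent_neg _) (sqr_pent _)).
  by rewrite (c_form _ _ _ _ (sqr_pent_neg _) (sqr_pent_neg _)).
have [Y ->] := shifted_sum0_mod8 qN0.
rewrite !(raddfD, raddfB) /= !mulr_natl !raddfMn raddfN /= psi0 alt0 mix0.
rewrite !mul0rn oppr0 !add0r; apply/dvdzP; exists (c Y).
by rewrite mulr_natr.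
Qed.

(** * From truncated sums to the power series *)

Lemma fps_mul_coef (f g : fps) (u v : {poly int}) (m : nat) :
  (forall i, (i <= m)%N -> f i = u`_i) -> (forall i, (i <= m)%N -> g i = v`_i) ->
  fps_mul f g m = (u * v)`_m.
Proof.
move=> fu gv; rewrite coefM; apply: eq_bigr => i _.
by rewrite fu ?gv ?leq_subr // -ltnS.
Qed.

Lemma S1_coef (B : nat) : S1 B =
  (\sum_(n < B.+1) (\prod_(k < B.+1) (1 + 'X^(n.+1 + k))) ^+ 2 * 'X^n)`_B.
Proof.
rewrite -(S1_cvg (ltnSn B)) coef_sum; apply: eq_bigr => n _.
have P i : (i <= B)%N ->
    qpoch_inf (- 'X^(n.+1)) i = (\prod_(k < B.+1) (1 + 'X^(n.+1 + k)))`_i.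
  move=> iB; rewrite -(@qpoch_inf_cvg _ i B.+1) //; congr (polyseq _)`_i.
  by apply: eq_bigr => k _; rewrite mulNr opprK -exprD.
apply: fps_mul_coef => // i iB; rewrite expr2; apply: fps_mul_coef => j ji.
all: exact/P/(leq_trans ji).
Qed.

Lemma coef_in_qpoly_Xn (A : comNzRingType) (B : nat) (f : {poly A}) :
  (in_qpoly 'X^(B.+1) f : {poly A})`_B = f`_B.
Proof.
rewrite /= mk_monic_Xn -Pdiv.RingMonic.take_poly_rmodp.
by rewrite coef_take_poly ltnSn.
Qed.

Lemma dvd8_s1 (B : nat) :
  (forall x y, (24 * B + 3 <> x ^ 2 + 2 * y ^ 2)%N) -> (8 %| s1 B)%Z.
Proof.
move=> noform.
pose Q := {poly %/ ('X^(B.+1) : {poly int})}.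
pose phi : {rmorphism {poly int} -> Q} := in_qpoly 'X^(B.+1).
pose c : Q -> int := coefp B \o @polyn _ _.
have cphi f : c (phi f) = f`_B by exact: coef_in_qpoly_Xn.
have qN0 : phi 'X ^+ B.+1 = 0.
  rewrite -rmorphXn; apply: val_inj => /=.
  by rewrite mk_monic_Xn Pdiv.RingMonic.rmodpp // monicXn.
suff -> : s1 B = c (shifted_sum (phi 'X) B.+1 0).
  apply: (@dvd8_coef_shifted_sum Q _ _ c) => // e x y eB.
  rewrite -[LHS]/(c (phi 'X ^+ e)) -rmorphXn cphi coefXn; case: eqP => // Be.
  by case: (noform x y); rewrite Be.
rewrite /s1 S1_coef -cphi; congr (c _).
rewrite rmorph_sum /shifted_sum big_mkord; apply: eq_bigr => n _.
rewrite big_ord0 mulr1 addn0 rmorphM rmorphXn rmorphXn mulrC -mulrA -expr2.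
congr (_ * _ ^+ 2); rewrite rmorph_prod; apply: eq_bigr => k _.
by rewrite rmorphD rmorph1 rmorphXn.
Qed.

Local Close Scope ring_scope.

Theorem theorem1p4 (p n k : nat) (p_prime : prime p)
    (p_mod8 : p = 5 %[mod 8] \/ p = 7 %[mod 8]) (p_ndvd_n : ~~ (p %| n)) :
  (s1 (p ^ (2 * k + 1) * n + (p ^ (2 * k + 2) - 1) %/ 8)%N = 0 %[mod 8])%Z.
Proof.
apply/eqP; rewrite eqz_mod_dvd subr0; apply: dvd8_s1 => x y.
have p_odd : odd p by case: p_mod8 => e; lia.
have pNc : ~~ (p %| 3 * (8 * n + p)).
  have p_ge5 : 5 <= p by case: p_mod8 => e; lia.
  rewrite Euclid_dvdM // dvdn_addl // Euclid_dvdM // (negPf p_ndvd_n) orbF.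
  by rewrite -[8]/(2 ^ 3) Euclid_dvdX // !gtnNdvd //; lia.
have sq8 : (8 * ((p ^ (2 * k + 2) - 1) %/ 8) = p ^ (2 * k + 2) - 1)%N.
  have -> : (p ^ (2 * k + 2) = (p ^ k.+1) ^ 2)%N.
    by rewrite -expnM; congr (_ ^ _)%N; lia.
  have : odd (p ^ k.+1) by rewrite oddX p_odd orbT.
  move: (p ^ k.+1)%N => r r_odd.
  have -> : r = (2 * r./2 + 1)%N by lia.
  by rewrite -sqr_bin2 addnK mulKn.
have pk : (0 < p ^ (2 * k + 2))%N by rewrite expn_gt0 prime_gt0.
have e2 : (p ^ (2 * k + 2) = p ^ (2 * k + 1) * p)%N.
  by rewrite -expnSr; congr (_ ^ _)%N; lia.
have -> : (24 * (p ^ (2 * k + 1) * n + (p ^ (2 * k + 2) - 1) %/ 8) + 3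
   = p ^ (2 * k + 1) * (3 * (8 * n + p)))%N by nia.
exact: odd_pow_ne_form.
Qed.
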